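(* Let $P$ be a monoid and let $\Lambda$ be a nonempty $P$-graph such that $\Lambda^0$ has property $\mathsf{W}$. Then the following hold. (i) $\operatorname{Per}\Lambda$ is a subgroup of $\mathcal{G}(P)$. (ii) If $\Lambda^0_{\operatorname{Per}}$ is non-empty, then it is a hereditary subset of $\Lambda^0$. (iii) Let $\mathbf{q}:\mathcal{G}(P)\to\mathcal{G}(P)/\operatorname{Per}\Lambda$ be the quotient map. Then $\Gamma:=\Lambda^0_{\operatorname{Per}}\Lambda/\!\sim$ is a $\mathbf{q}(P)$-graph with degree map $\tilde d:=\mathbf{q}\circ d$. (iv) $\Lambda^0_{\operatorname{Per}}\Lambda$ is isomorphic to the pullback $\mathbf{q}^*\Gamma$ via $\lambda\mapsto([\lambda],d(\lambda))$.
   Context: All monoids are finitely generated, cancellative and abelian; $P$ is embedded in its Grothendieck group $\mathcal{G}(P)$ and is also regarded as a category with one object. A $P$-graph is a countable small category $\Lambda$ (identified with its set of morphisms) with a functor $d:\Lambda\to P$ satisfying the factorization property: whenever $d(\xi)=p+q$ there are unique $\eta,\zeta\in\Lambda$ with $d(\eta)=p$, $d(\zeta)=q$, $\xi=\eta\zeta$. $\Lambda^p=d^{-1}(p)$, $\Lambda^0$ is the vertex set, $r,s:\Lambda\to\Lambda^0$ are the range and source maps, $v\Lambda=\{\xi:r(\xi)=v\}$, $v\Lambda^p=v\Lambda\cap\Lambda^p$, $u\Lambda w=\{\xi: r(\xi)=u,s(\xi)=w\}$. All $P$-graphs are assumed row-finite and source-free: $0<|v\Lambda^p|<\infty$ for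 all $v\in\Lambda^0$, $p\in P$. A subset $S\subseteq\Lambda^0$ is hereditary if $v\in S$ and $v\Lambda w\neq\varnothing$ imply $w\in S$. $\Lambda^0$ has property $\mathsf{W}$ if for any $u,v\in\Lambda^0$ there is $w\in\Lambda^0$ with $u\Lambda w\ne\varnothing$ and $v\Lambda w\neq\varnothing$. $\Omega_P=\{(p,q)\in P\times P: q-p\in P\}$ is the $P$-graph with $d(p,q)=q-p$, $s(p,q)=q$, $r(p,q)=p$. An infinite path of $\Lambda$ is a degree-preserving functor $x:\Omega_P\to\Lambda$; $\Lambda^\infty$ is the set of these, and $v\Lambda^\infty$ the set of those with range $x(0,0)=v$. For $\mu\in\Lambda$ and $x\in s(\mu)\Lambda^\infty$, $\mu x$ is the unique infinite path with $(\mu x)(0,p)=\mu\cdot x(0,p-d(\mu))$ for all $p\in P$ with $p-d(\mu)\in P$. The equivalence relation $\sim$ on $\Lambda$: $\xi\sim\eta$ iff $s(\xi)=s(\eta)$ and $\xi x=\eta x$ for all $x\in s(\xi)\Lambda^\infty$ (then also $r(\xi)=r(\eta)$). The quotient is a category with $r([\xi])=[r(\xi)]$, $s([\xi])=[s(\xi)]$, $[\xi][\eta]=[\xi\eta]$ for composable $\xi,\eta$. $\operatorname{Per}\Lambda=\{d(\xi)-d(\eta):\xi,\eta\in\Lambda,\ \xi\sim\eta\}\subseteq\mathcal{G}(P)$. $\Lambda^0_{\operatorname{Per}}$ is the set of $v\in\Lambda^0$ such that for any $\xi\in v\Lambda$ and $p\in P$ with $d(\xi)-p\in\operatorname{Per}\Lambda$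 there is $\eta\in v\Lambda^p$ with $\xi\sim\eta$. $\Lambda^0_{\operatorname{Per}}\Lambda=\{\lambda\in\Lambda:r(\lambda)\in\Lambda^0_{\operatorname{Per}}\}$. For a monoid homomorphism $f:P\to Q$ and a $Q$-graph $(\Gamma,d_\Gamma)$, the pullback $f^*\Gamma$ is the $P$-graph $\{(\lambda,p)\in\Gamma\times P: d_\Gamma(\lambda)=f(p)\}$ with $d(\lambda,p)=p$, $s(\lambda,p)=s(\lambda)$, $r(\lambda,p)=r(\lambda)$, and $(\mu,p)(\nu,q)=(\mu\nu,p+q)$ if $s(\mu)=r(\nu)$. Here $\mathbf{q}^*\Gamma$ is the pullback via the restriction $\mathbf{q}:P\to\mathbf{q}(P)$. *)

(* Defs.v *)
From HB Require Import structures.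
From mathcomp Require Import all_boot all_algebra.
From mathcomp Require Import boolp classical_sets cardinality.

Set Implicit Arguments.
Unset Strict Implicit.
Unset Printing Implicit Defensive.

Import GRing.Theory.
Local Open Scope ring_scope.
Local Open Scope quotient_scope.
Local Open Scope classical_set_scope.

Definition cancellative (P : nmodType) : Prop :=
  forall p q r : P, p + q = p + r -> q = r.

Definition finitely_generated (P : nmodType) : Prop :=
  exists s : seq P, forall p : P,
    exists c : 'I_(size s) -> nat, p = \sum_(i < size s) s`_i *+ c i.

(* The class of (a, b) is the formal difference a - b. *)
Section Grothendieck.
Variable P : nmodType.

Definition groth_rel (x y : P * P) : bool :=
  `[< exists k, x.1 + y.2 + k = y.1 + x.2 + k >].

Lemma groth_rel_equiv : equiv_class_of groth_rel.
Proof.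
split=> [[a b]|[a b] [c d]|[c d] [a b] [e f]].
- by apply/asboolP; exists 0.
- by apply/asboolP/asboolP => -[k hk]; exists k.
- move=> /asboolP[k /= hk] /asboolP[l /= hl]; apply/asboolP.
  exists (d + k + (c + l)) => /=.
  rewrite [LHS](+%R.[AC (2*(2*2)) ((1*3*4)*(5*2*6))]) hk hl.
  by rewrite [LHS](+%R.[AC (3*3) ((4*2)*((5*3)*(1*6)))]).
Qed.

Canonical groth_equiv := EquivRelPack groth_rel_equiv.
Canonical groth_encModRel := defaultEncModRel groth_rel.

Definition groth : Type := {eq_quot groth_rel}.
HB.instance Definition _ : EqQuotient (P * P)%type groth_rel groth :=
  EqQuotient.on groth.
HB.instance Definition _ := Choice.on groth.

Definition groth_zero : groth := lift_cst groth (0, 0).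
Definition groth_add :=
  lift_op2 groth (fun x y : P * P => (x.1 + y.1, x.2 + y.2)).
Definition groth_opp := lift_op1 groth (fun x : P * P => (x.2, x.1)).

Canonical pi_groth_zero := PiConst groth_zero.

Lemma groth_eqP (x y : P * P) :
  reflect (exists k, x.1 + y.2 + k = y.1 + x.2 + k) (x == y %[mod groth]).
Proof. by rewrite piE; exact: asboolP. Qed.

Lemma pi_groth_oppE : {morph \pi : x / (x.2, x.1) >-> groth_opp x}.
Proof.
move=> x; unlock groth_opp; apply/eqP/groth_eqP => /=.
have /eqP/groth_eqP[k /= hk] := esym (reprK (\pi_groth x)).
by exists k; rewrite [x.2 + _]addrC -hk [x.1 + _]addrC.
Qed.
Canonical pi_groth_opp := PiMorph1 pi_groth_oppE.

Lemma pi_groth_addE :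
  {morph \pi : x y / (x.1 + y.1, x.2 + y.2) >-> groth_add x y}.
Proof.
move=> x y; unlock groth_add; apply/eqP/groth_eqP => /=.
have /eqP/groth_eqP[k /= hk] := esym (reprK (\pi_groth x)).
have /eqP/groth_eqP[l /= hl] := esym (reprK (\pi_groth y)).
exists (k + l).
rewrite [LHS](+%R.[AC (2*2*2) ((1*3*5)*(2*4*6))]) hk hl.
by rewrite [LHS](+%R.[AC (3*3) ((1*4)*(2*5)*(3*6))]).
Qed.
Canonical pi_groth_add := PiMorph2 pi_groth_addE.

Lemma groth_addA : associative groth_add.
Proof.
by move=> x y z; rewrite -[x]reprK -[y]reprK -[z]reprK !piE /= !addrA.
Qed.

Lemma groth_addC : commutative groth_add.
Proof.
move=> x y; rewrite -[x]reprK -[y]reprK !piE /=.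
by rewrite [X in (X, _)]addrC [X in (_, X)]addrC.
Qed.

Lemma groth_add0 : left_id groth_zero groth_add.
Proof. by move=> x; rewrite -[x]reprK !piE /= !add0r -surjective_pairing. Qed.

Lemma groth_addN : left_inverse groth_zero groth_opp groth_add.
Proof.
move=> x; rewrite -[x]reprK !piE /=; apply/eqP/groth_eqP => /=.
by exists 0; rewrite !addr0 add0r addrC.
Qed.

HB.instance Definition _ :=
  GRing.isZmodule.Build groth groth_addA groth_addC groth_add0 groth_addN.

Definition emb (p : P) : groth := \pi_groth (p, 0).

Lemma emb_is_nmod_morphism : nmod_morphism emb.
Proof.
split=> [|p q]; first by rewrite /emb [RHS]piE.
by rewrite /emb [RHS]piE /= addr0.
Qed.
HB.instance Definition _ :=
  GRing.isNmodMorphism.Build P groth emb emb_is_nmod_morphism.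

End Grothendieck.

Section Subgroup.
Variables (G : zmodType) (H : {pred G}) (HH : zmod_closed H).

Let subgroup_set : G -> bool := fun g => g \in H.
Let subgroup_setP : zmod_closed subgroup_set := HH.

Definition subgroup : zmodClosed G :=
  HB.pack subgroup_set (GRing.isZmodClosed.Build G subgroup_set subgroup_setP).

Definition quotient_map : {additive G -> Quotient.quot subgroup} :=
  \pi_(Quotient.quot subgroup).

End Subgroup.

Section Image.
Variables (P Q : nmodType) (f : {additive P -> Q}).

Definition in_image : Q -> bool := fun y => `[< exists p, y = f p >].

Lemma in_image_addumagma_closed : Algebra.addumagma_closed in_image.
Proof.
split=> [|x y /asboolP[p ->] /asboolP[q ->]]; apply/asboolP.
  by exists 0; rewrite raddf0.
by exists (p + q); rewrite raddfD.
Qed.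
HB.instance Definition _ :=
  GRing.isAddClosed.Build Q in_image in_image_addumagma_closed.

Definition image_monoid : Type := {y : Q | in_image y}.
HB.instance Definition _ := SubChoice.on image_monoid.
HB.instance Definition _ := GRing.SubChoice_isSubNmodule.Build Q in_image
  image_monoid in_image_addumagma_closed.

Lemma in_imageT p : in_image (f p).
Proof. by apply/asboolP; exists p. Qed.

Definition corestrict (p : P) : image_monoid := exist _ (f p) (in_imageT p).

Lemma corestrict_is_nmod_morphism : nmod_morphism corestrict.
Proof.
by split=> [|p q]; apply: val_inj; rewrite /= ?raddf0 ?raddfD.
Qed.
HB.instance Definition _ := GRing.isNmodMorphism.Build P image_monoid corestrict
  corestrict_is_nmod_morphism.

End Image.

(* A category is identified with its set of morphisms: rng and src take values
   in identity morphisms, which are the vertices.  The total operation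
   compose x y is composition "x after y" and is meaningful only when
   src x = rng y; nothing is assumed of its other values. *)
Record graph_data (P : nmodType) := GraphData {
  mor :> choiceType;
  rng : mor -> mor;
  src : mor -> mor;
  compose : mor -> mor -> mor;
  deg : mor -> P
}.

Section Graphs.
Variable P : nmodType.

Section Basics.
Variable L : graph_data P.

Definition vertices : set L := [set v | rng v = v].

Record is_category : Prop := IsCategory {
  rng_rng : forall x : L, rng (rng x) = rng x;
  src_rng : forall x : L, src (rng x) = rng x;
  rng_src : forall x : L, rng (src x) = src x;
  src_src : forall x : L, src (src x) = src x;
  rng_comp : forall x y : L, src x = rng y -> rng (compose x y) = rng x;
  src_comp : forall x y : L, src x = rng y -> src (compose x y) = src y;
  comp_rng : forall x : L, compose (rng x) x = x;
  comp_src : forall x : L, compose x (src x) = x;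
  comp_assoc : forall x y z : L, src x = rng y -> src y = rng z ->
    compose x (compose y z) = compose (compose x y) z
}.

(* Row-finiteness and absence of sources are part of the definition. *)
Record is_pgraph : Prop := IsPGraph {
  pgraph_category : is_category;
  pgraph_countable : countable [set: L];
  deg_id : forall v : L, vertices v -> deg v = 0;
  deg_comp : forall x y : L, src x = rng y -> deg (compose x y) = deg x + deg y;
  factorization : forall (x : L) (p q : P), deg x = p + q ->
    exists! yz : L * L, [/\ deg yz.1 = p, deg yz.2 = q,
                            src yz.1 = rng yz.2 & x = compose yz.1 yz.2];
  row_finite : forall (v : L) (p : P), vertices v ->
    finite_set [set x : L | rng x = v /\ deg x = p];
  source_free : forall (v : L) (p : P), vertices v ->
    exists x : L, rng x = v /\ deg x = p
}.

Definition connected (u w : L) : Prop := exists x : L, rng x = u /\ src x = w.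

Definition hereditary (S : set L) : Prop :=
  S `<=` vertices /\
  forall v w : L, S v -> vertices w -> connected v w -> S w.

Definition property_W : Prop :=
  forall u v : L, vertices u -> vertices v ->
    exists w : L, [/\ vertices w, connected u w & connected v w].

End Basics.

Record is_morphism (X Y : graph_data P) (F : X -> Y) : Prop := IsMorphism {
  morphism_rng : forall x : X, F (rng x) = rng (F x);
  morphism_src : forall x : X, F (src x) = src (F x);
  morphism_comp : forall x y : X, src x = rng y ->
    F (compose x y) = compose (F x) (F y);
  morphism_deg : forall x : X, deg (F x) = deg x
}.

Definition is_isomorphism (X Y : graph_data P) (F : X -> Y) : Prop :=
  is_morphism F /\ bijective F.

(* Omega_P; insubd supplies an irrelevant value for non-composable pairs. *)
Definition omega_pred (pq : P * P) : bool :=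
  `[< exists t : P, emb pq.2 - emb pq.1 = emb t >].

Definition omega_type : choiceType := {pq : P * P | omega_pred pq}.

Lemma omega_diag p : omega_pred (p, p).
Proof. by apply/asboolP; exists 0; rewrite subrr raddf0. Qed.

Lemma omega_from0 p : omega_pred (0, p).
Proof. by apply/asboolP; exists p; rewrite raddf0 subr0. Qed.

Definition omega : graph_data P := @GraphData P omega_type
  (fun x => exist _ ((val x).1, (val x).1) (omega_diag (val x).1))
  (fun x => exist _ ((val x).2, (val x).2) (omega_diag (val x).2))
  (fun x y => insubd x ((val x).1, (val y).2))
  (fun x => xget 0 [set t | emb (val x).2 - emb (val x).1 = emb t]).

Definition from0 (p : P) : omega := exist _ (0, p) (omega_from0 p).

Section Periodicity.
Variable L : graph_data P.

Definition infinite_path (x : omega -> L) : Prop := is_morphism x.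

Definition path_range (x : omega -> L) : L := x (from0 0).

(* mu x is the infinite path characterised by this set; it is used only when
   path_range x = src mu, and the default value x is then irrelevant. *)
Definition prepend (mu : L) (x : omega -> L) : omega -> L :=
  xget x [set y : omega -> L | infinite_path y /\
    forall p t : P, emb p - emb (deg mu) = emb t ->
      y (from0 p) = compose mu (x (from0 t))].

Definition sim (xi eta : L) : Prop :=
  src xi = src eta /\
  forall x : omega -> L, infinite_path x -> path_range x = src xi ->
    prepend xi x = prepend eta x.

Lemma sim_refl xi : sim xi xi.
Proof. by []. Qed.

Lemma sim_sym xi eta : sim xi eta -> sim eta xi.
Proof. by move=> [s h]; split=> // x xP; rewrite -s => /(h x xP). Qed.

Lemma sim_trans xi eta zeta : sim xi eta -> sim eta zeta -> sim xi zeta.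
Proof.
move=> [s h] [s' h']; split=> [|x xP xr]; first by rewrite s.
by rewrite h // h' // xr.
Qed.

Definition Per : {pred groth P} := fun g =>
  `[< exists xi eta : L, sim xi eta /\ g = emb (deg xi) - emb (deg eta) >].

Definition VPer : set L := [set v | vertices v /\
  forall (xi : L) (p : P), rng xi = v -> emb (deg xi) - emb p \in Per ->
    exists eta : L, [/\ rng eta = v, deg eta = p & sim xi eta]].

End Periodicity.

(* S L = {x in L : r(x) in S}, a subcategory as soon as S is hereditary; the
   default values of insubd are then irrelevant. *)
Definition restriction_type (L : graph_data P) (S : set L) : choiceType :=
  {x : L | rng x \in S}.

Definition restriction (L : graph_data P) (S : set L) : graph_data P :=
  @GraphData P (restriction_type S)
    (fun x => insubd x (rng (val x)))
    (fun x => insubd x (src (val x)))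
    (fun x y => insubd x (compose (val x) (val y)))
    (fun x => deg (val x)).

End Graphs.

Arguments Per {P} L _.
Arguments VPer {P} L _.

Section Pullback.
Variables (P Q : nmodType) (f : {additive P -> Q}) (G : graph_data Q).

Definition pullback_type : choiceType :=
  {xp : (G : choiceType) * P | deg xp.1 == f xp.2}.

(* In a Q-graph all the values below satisfy the defining condition of
   pullback_type, for compose as soon as the arguments are composable. *)
Definition pullback : graph_data P := @GraphData P pullback_type
  (fun x => insubd x (rng (val x).1, 0))
  (fun x => insubd x (src (val x).1, 0))
  (fun x y => insubd x (compose (val x).1 (val y).1, (val x).2 + (val y).2))
  (fun x => (val x).2).

End Pullback.

Section QuotientGraph.
Variables (P : nmodType) (L : graph_data P).

Let R := restriction (VPer L).

Definition per_rel (x y : R) : bool := `[< sim (val x) (val y) >].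

Lemma per_rel_equiv : equiv_class_of per_rel.
Proof.
split=> [x|x y|y x z].
- by apply/asboolP; exact: sim_refl.
- by apply/asboolP/asboolP; exact: sim_sym.
- by move=> /asboolP xy /asboolP yz; apply/asboolP; exact: sim_trans xy yz.
Qed.

Canonical per_equiv := EquivRelPack per_rel_equiv.
Canonical per_encModRel := defaultEncModRel per_rel.

Definition per_quot : choiceType := {eq_quot per_rel}.

Definition cls (x : R) : per_quot := \pi_({eq_quot per_rel}) x.

Variable HPer : zmod_closed (Per L).

(* The map P -> G(P) / Per. *)
Definition qmap : {additive P -> Quotient.quot (subgroup HPer)} :=
  quotient_map HPer \o @emb P.

Definition qP : nmodType := image_monoid qmap.

Definition qrestr : {additive P -> qP} := @corestrict P _ qmap.

Definition Gamma : graph_data qP := @GraphData qP per_quot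
  (fun X => cls (rng (repr X)))
  (fun X => cls (src (repr X)))
  (fun X Y => cls (compose (repr X) (repr Y)))
  (fun X => qrestr (deg (repr X))).

End QuotientGraph.

(* Main.v *)
(** An infinite path x is determined by its initial segments x(0, p), so the
  infinite paths form a set of rays P -> L on which L acts by prepending [act]
  and P acts by [shift].  If x ~ y with degrees m and n, then for every ray f
  at the common source
    shift n f = shift (m + n) (x f) = shift (m + n) (y f) = shift m f,
  and conversely an identity shift m = shift n on all rays at one vertex
  yields equivalent paths of degrees n and m.  Such an identity passes along
  paths, so property W brings any two of them to a common vertex, where they
  can be added: Per is a group.  Equivalent paths of the same degree are equal
  (both are the initial segment of that degree of x f = y f); over VPer, every
  class thus has exactly one representative in each admissible degree, which
  gives unique factorization in the quotient and the pullback isomorphism. *)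

Require Import Defs.
From HB Require Import structures.
From mathcomp Require Import all_boot all_algebra.
From mathcomp Require Import boolp classical_sets cardinality.

Set Implicit Arguments.
Unset Strict Implicit.
Unset Printing Implicit Defensive.

Import GRing.Theory.
Local Open Scope ring_scope.
Local Open Scope classical_set_scope.

(** * Cancellation and cofinality in monoids *)

Lemma cancellative_addIr (P : nmodType) (p q r : P) :
  cancellative P -> p + r = q + r -> p = q.
Proof. by move=> Pc; rewrite ![_ + r]addrC; exact: Pc. Qed.

Lemma embD (P : nmodType) (p q : P) : emb (p + q) = emb p + emb q.
Proof. exact: raddfD. Qed.

Lemma emb_inj (P : nmodType) : cancellative P -> injective (@emb P).
Proof.
move=> Pc p q /eqP/groth_eqP[k /=]; rewrite !addr0.
exact: cancellative_addIr.
Qed.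

(** The sum of all generators serves: multiplied by the total of the coefficients of [p], it
    dominates each of them. Infinite paths can then be built along the multiples of a single
    element. *)
Lemma finitely_generated_cofinal (P : nmodType) : finitely_generated P ->
  exists e : P, forall p, exists n q, e *+ n = p + q.
Proof.
move=> [s sP]; exists (\sum_(i < size s) s`_i) => p.
have [c ->] := sP p; exists (\sum_i c i)%N.
exists (\sum_(i < size s) s`_i *+ (\sum_(j | j != i) c j)%N).
rewrite -sumrMnl -big_split /=; apply: eq_bigr => i _.
by rewrite -mulrnDr (bigD1 i).
Qed.

(** * Rays, prepending and shifts *)

Section PGraph.
Variables (P : nmodType) (L : graph_data P).
Hypotheses (Pcanc : cancellative P) (LP : is_pgraph L).
Implicit Types (x y z v w : L) (p q m n : P).

Let Lcat : is_category L := pgraph_category LP.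
Let rngr := rng_rng Lcat.
Let srcr := src_rng Lcat.
Let rngs := rng_src Lcat.
Let srcs := src_src Lcat.
Let rngc := rng_comp Lcat.
Let srcc := src_comp Lcat.
Let compA := comp_assoc Lcat.
Let degc := deg_comp LP.

Lemma vertices_rng x : vertices (rng x). Proof. exact: rngr. Qed.

Lemma vertices_src x : vertices (src x). Proof. exact: rngs. Qed.

Lemma src_vertex v : vertices v -> src v = v.
Proof. by move=> /= <-; exact: srcr. Qed.

Lemma deg_rng x : deg (rng x) = 0. Proof. exact: deg_id (vertices_rng x). Qed.

(** Cancellation carries equality of degrees from the first factors to the second ones, so that
    unique factorization applies. *)
Lemma factorization_unique x y x' y' :
  src x = rng y -> src x' = rng y' -> compose x y = compose x' y' ->
  deg x = deg x' -> x = x' /\ y = y'.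
Proof.
move=> xy xy' e d.
have d2 : deg y = deg y'.
  by apply: (Pcanc (p := deg x)); rewrite -degc// e degc// d.
have [yz [_ yzP]] := factorization LP (degc xy).
have e1 := yzP (x, y) (And4 erefl erefl xy erefl).
have e2 := yzP (x', y') (And4 (esym d) (esym d2) xy' e).
by have := etrans (esym e1) e2 => -[].
Qed.

Lemma compI x y z : src x = rng y -> src x = rng z ->
  compose x y = compose x z -> y = z.
Proof. by move=> xy xz /(factorization_unique xy xz)[]. Qed.

(** Both [rng x] and [x] are initial factors of [x] of degree 0. *)
Lemma deg0_vertex x : deg x = 0 -> x = rng x.
Proof.
move=> d.
have e : compose (rng x) x = compose x (src x).
  by rewrite (comp_rng Lcat) (comp_src Lcat).
by have [] := factorization_unique (srcr x) (esym (rngs x)) e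
  (etrans (deg_rng x) (esym d)).
Qed.

(** * The prefix order on paths *)

Definition prefix x y := exists2 c, src x = rng c & y = compose x c.

Lemma prefix_trans x y z : prefix x y -> prefix y z -> prefix x z.
Proof.
move=> [c xc ->] [d cd ->]; rewrite srcc// in cd.
by exists (compose c d); rewrite ?rngc// compA.
Qed.

Lemma prefix_rng x y : prefix x y -> rng x = rng y.
Proof. by move=> [c xc ->]; rewrite rngc. Qed.

Lemma prefix_refl x : prefix x x.
Proof. by exists (src x); rewrite ?rngs ?(comp_src Lcat). Qed.

Lemma prefix_inj x y z : prefix x z -> prefix y z -> deg x = deg y -> x = y.
Proof.
move=> [c xc ->] [d yd e] h.
by have [] := factorization_unique xc yd e h.
Qed.

Lemma prefix_exists x p q : deg x = p + q -> exists y, deg y = p /\ prefix y x.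
Proof.
move=> /(factorization LP)[[y z]] [[/= yp zq yz ->] _].
by exists y; split=> //; exists z.
Qed.

Lemma prefix_deg x y : prefix x y -> exists q, deg y = deg x + q.
Proof. by move=> [c xc ->]; exists (deg c); rewrite degc. Qed.

(** The prefix of [y] of degree [deg x] is also a prefix of [z], hence equals [x]. *)
Lemma prefix_comparable x y z q : prefix x z -> prefix y z ->
  deg y = deg x + q -> prefix x y.
Proof.
move=> xz yz dy; have [x' [dx' x'y]] := prefix_exists dy.
by rewrite (prefix_inj xz (prefix_trans x'y yz)).
Qed.

Lemma prefix_comp x y z : src x = rng y -> prefix y z ->
  prefix (compose x y) (compose x z).
Proof.
by move=> xy [c yc ->]; exists c; rewrite ?srcc// compA.
Qed.

(** The default [x] is reached only when [deg x] does not lie in [p + P]. *)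
Definition head p x : L := xget x [set y | deg y = p /\ prefix y x].

Lemma headP p q x : deg x = p + q -> deg (head p x) = p /\ prefix (head p x) x.
Proof. by move=> /prefix_exists e; exact: (xgetPex x e). Qed.

Lemma head_eq p x y : prefix y x -> deg y = p -> head p x = y.
Proof.
move=> yx yp; have [q] := prefix_deg yx; rewrite yp => /headP[d h].
by apply: prefix_inj h yx _; rewrite d.
Qed.

(* The initial segments x(0, p) of an infinite path x. *)
Definition ray (f : P -> L) : Prop :=
  (forall p, deg (f p) = p) /\ forall p q, prefix (f p) (f (p + q)).

Lemma ray_deg f p : ray f -> deg (f p) = p. Proof. by case. Qed.

Lemma ray_rng f p : ray f -> rng (f p) = f 0.
Proof.
move=> [fd fp]; rewrite -[p]add0r -(prefix_rng (fp 0 p)).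
by rewrite -deg0_vertex.
Qed.

(** Agreement on the cofinal set [m + P] suffices: [f p] and [g p] are both the prefix of degree [p]
    of [f (p + m)]. *)
Lemma ray_ext m f g : ray f -> ray g -> (forall t, f (m + t) = g (m + t)) ->
  f = g.
Proof.
move=> [fd fp] [gd gp] fg; apply/funext => p.
apply: (@prefix_inj _ _ (f (p + m))); rewrite ?fd ?gd//.
by rewrite addrC fg addrC.
Qed.

Lemma ray_exists v : finitely_generated P -> vertices v ->
  exists2 f, ray f & f 0 = v.
Proof.
move=> /finitely_generated_cofinal[e eP] vv.
have /choice[g gP] (u : L) : exists y, rng y = src u /\ deg y = e.
  exact (source_free LP e (vertices_src u)).
(* An infinite concatenation of paths of degree [e], which exist since there are no sources; its
   prefixes will form the ray. *)
pose fix zz (n : nat) : L := if n is k.+1 then compose (zz k) (g (zz k)) else v.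
have zd (n : nat) : deg (zz n) = e *+ n.
  elim: n => [|n IH]; first by rewrite (deg_id LP vv).
  by rewrite /= degc ?(gP _).1// IH (gP _).2 mulrSr.
have zp (n k : nat) : prefix (zz n) (zz (n + k)%N).
  elim: k => [|k IH]; first by rewrite addn0; exact: prefix_refl.
  rewrite addnS; apply: prefix_trans IH _.
  by exists (g (zz (n + k)%N)) => //; rewrite (gP _).1.
have /choice[N NP] := eP.
pose f p := head p (zz (N p)).
have fP p : deg (f p) = p /\ prefix (f p) (zz (N p)).
  by have [q hq] := NP p; apply: (@headP p q); rewrite zd.
exists f.
  split=> [p|p q]; first by have [] := fP p.
  (* The segments of degrees [p] and [p + q] are compared inside a common later stage of the
     concatenation. *)
  apply: (@prefix_comparable _ _ (zz (N p + N (p + q)%R)%N) q).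
  - exact: prefix_trans (fP p).2 (zp _ _).
  - by rewrite addnC; apply: prefix_trans (fP (p + q)).2 (zp _ _).
  - by rewrite !(fP _).1.
rewrite (deg0_vertex (fP 0).1) (prefix_rng (fP 0).2).
by rewrite -(prefix_rng (zp 0%N (N 0))).
Qed.

(** As [compose x (f p)] has degree [deg x + p], it has a prefix of degree [p] for every [p],
    whether or not [p] lies in [deg x + P]. *)
Definition act x f p : L := head p (compose x (f p)).

Lemma act_prefix x f p : ray f -> src x = f 0 ->
  deg (act x f p) = p /\ prefix (act x f p) (compose x (f p)).
Proof.
move=> fR xf; apply: (@headP p (deg x)).
by rewrite degc ?ray_rng// ray_deg// addrC.
Qed.

Lemma ray_act x f : ray f -> src x = f 0 -> ray (act x f).
Proof.
move=> fR xf; have aP p := act_prefix p fR xf; split=> [p|p q].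
  by have [] := aP p.
apply: (@prefix_comparable _ _ (compose x (f (p + q))) q).
- apply: prefix_trans (aP p).2 _; apply: prefix_comp; first by rewrite ray_rng.
  exact: fR.2.
- exact: (aP _).2.
- by rewrite !(aP _).1.
Qed.

Lemma actE x f t : ray f -> src x = f 0 ->
  act x f (deg x + t) = compose x (f t).
Proof.
move=> fR xf; apply: head_eq; last by rewrite degc ?ray_rng// ray_deg.
apply: prefix_comp; first by rewrite ray_rng.
by rewrite addrC; exact: fR.2.
Qed.

(** This is the property by which [prepend] is specified; it determines the ray because [deg x + P]
    is cofinal. *)
Lemma act_unique x f g : ray f -> src x = f 0 -> ray g ->
  (forall t, g (deg x + t) = compose x (f t)) -> g = act x f.
Proof.
move=> fR xf gR gE; apply: (@ray_ext (deg x)) => // [|t].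
  exact: ray_act.
by rewrite gE actE.
Qed.

Lemma act_deg x f : ray f -> src x = f 0 -> act x f (deg x) = x.
Proof.
by move=> fR xf; rewrite -[deg x]addr0 actE// -xf (comp_src Lcat).
Qed.

Lemma act0 x f : ray f -> src x = f 0 -> act x f 0 = rng x.
Proof.
move=> fR xf; have aR := ray_act fR xf.
by rewrite -(ray_rng (deg x) aR) act_deg.
Qed.

Lemma act_comp x y f : ray f -> src x = rng y -> src y = f 0 ->
  act (compose x y) f = act x (act y f).
Proof.
move=> fR xy yf; apply/esym/act_unique; rewrite ?srcc//.
  by apply: ray_act; rewrite ?act0//; exact: ray_act.
move=> t; rewrite degc// -addrA actE ?act0//; last exact: ray_act.
by rewrite actE// compA// ray_rng.
Qed.

(** The tail of [f] after [f m], unique by left cancellation; for a ray the default [f p] is never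
    reached. *)
Definition shift m f p : L :=
  xget (f p) [set c | src (f m) = rng c /\ f (m + p) = compose (f m) c].

Lemma shiftP m f p : ray f -> src (f m) = rng (shift m f p) /\
  f (m + p) = compose (f m) (shift m f p).
Proof.
move=> fR; have [c mc e] := fR.2 m p.
exact: (@xgetI _ _ [set c | src (f m) = rng c /\ _ = compose (f m) c] c).
Qed.

Lemma shift_unique m f g : ray f ->
  (forall p, src (f m) = rng (g p)) ->
  (forall p, f (m + p) = compose (f m) (g p)) -> shift m f = g.
Proof.
move=> fR g0 gE; apply/funext => p; have [h e] := shiftP m p fR.
by apply: (compI h); rewrite ?g0// -e gE.
Qed.

Lemma ray_shift m f : ray f -> ray (shift m f).
Proof.
move=> fR; have sP p := shiftP m p fR; split=> [p|p q].
  apply: (Pcanc (p := m)); rewrite -{1}(ray_deg m fR) -degc.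
    by rewrite -(sP _).2 ray_deg.
  exact: (sP _).1.
(* Both [f (m + p)] and [f (m + p + q)] begin with [f m]; cancelling it shows that the same [c]
   extends the tails. *)
have [c pc e] := fR.2 (m + p) q.
move: pc e; rewrite (sP p).2 srcc ?(sP p).1// => pc.
rewrite -compA// ?(sP p).1// -addrA (sP _).2 => /compI e.
exists c => //; apply: e; first exact: (sP _).1.
by rewrite rngc// -(sP p).1.
Qed.

Lemma shift0 m f : ray f -> shift m f 0 = src (f m).
Proof.
move=> fR; have [-> _] := shiftP m 0 fR; apply: deg0_vertex.
exact: ray_deg (ray_shift m fR).
Qed.

Lemma shift_act x f : ray f -> src x = f 0 -> shift (deg x) (act x f) = f.
Proof.
move=> fR xf; apply: shift_unique => [|p|p]; first exact: ray_act.
  by rewrite act_deg// ray_rng.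
by rewrite act_deg// actE.
Qed.

Lemma shift_shift m n f : ray f -> shift n (shift m f) = shift (m + n) f.
Proof.
move=> fR; have sR := ray_shift m fR; apply/esym/shift_unique => // p.
  have [mn ->] := shiftP m n fR.
  by rewrite srcc//; have [] := shiftP n p sR.
have [mn ->] := shiftP m n fR.
have [mnp e] := shiftP n p sR.
by rewrite -compA// -e -addrA (shiftP m _ fR).2.
Qed.

Lemma act_inj x f g : ray f -> ray g -> src x = f 0 -> src x = g 0 ->
  act x f = act x g -> f = g.
Proof.
by move=> fR gR xf xg e; rewrite -(shift_act fR xf) e shift_act.
Qed.

(** * Infinite paths are rays *)

Definition ray_of (x : omega P -> L) p : L := x (from0 p).

Lemma omega_degE (a : omega P) p :
  (val a).2 = (val a).1 + p -> deg a = p.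
Proof.
move=> e; have h : emb (val a).2 - emb (val a).1 = emb p.
  by rewrite e raddfD /= addrC addKr.
have /= := xgetI 0 (h : [set t | _ = emb t] p).
by rewrite h => /(emb_inj Pcanc) <-.
Qed.

Lemma omega_deg (a : omega P) : (val a).2 = (val a).1 + deg a.
Proof.
have /asboolP[t h] := valP a; suff e : (val a).2 = (val a).1 + t.
  by rewrite (omega_degE e).
by apply: (emb_inj Pcanc); rewrite raddfD /= -h addrC subrK.
Qed.

Lemma omega_predD p t : omega_pred (p, p + t).
Proof. by apply/asboolP; exists t; rewrite /= raddfD /= addrC addKr. Qed.

Lemma omega_composable (a b : omega P) : src a = rng b ->
  (val a).2 = (val b).1.
Proof. by move=> /(congr1 (fun c : omega P => (val c).1)). Qed.

Lemma omega_compE (a b : omega P) : src a = rng b ->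
  val (compose a b) = ((val a).1, (val b).2).
Proof.
move=> /omega_composable ab; rewrite [LHS]val_insubd ifT//.
rewrite (omega_deg b) -ab (omega_deg a) -addrA.
exact: omega_predD.
Qed.

Definition segment p t : omega P := insubd (from0 p) (p, p + t).

Lemma val_segment p t : val (segment p t) = (p, p + t).
Proof. by rewrite val_insubd omega_predD. Qed.

Lemma segmentE (a : omega P) : a = segment (val a).1 (deg a).
Proof.
by apply: val_inj; rewrite val_segment -omega_deg -surjective_pairing.
Qed.

Lemma from0_comp p t : src (from0 p) = rng (segment p t) /\
  from0 (p + t) = compose (from0 p) (segment p t).
Proof.
have h : src (from0 p) = rng (segment p t).
  by apply: val_inj => /=; rewrite val_segment.
by split=> //; apply: val_inj; rewrite omega_compE// val_segment.
Qed.

Lemma path_rayP (x : omega P -> L) p t : infinite_path x ->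
  src (ray_of x p) = rng (x (segment p t)) /\
  ray_of x (p + t) = compose (ray_of x p) (x (segment p t)).
Proof.
move=> xP; have [h e] := from0_comp p t; rewrite /ray_of e.
by rewrite (morphism_comp xP)// -(morphism_src xP) -(morphism_rng xP) h.
Qed.

Lemma ray_of_path (x : omega P -> L) : infinite_path x -> ray (ray_of x).
Proof.
move=> xP; split=> [p|p q].
  by rewrite (morphism_deg xP) (@omega_degE _ p)//= add0r.
by have [h e] := path_rayP p q xP; exists (x (segment p q)).
Qed.

(** The value of a path at [(p, p + t)] is the unique factor completing its segment of degree [p] to
    that of degree [p + t]. *)
Lemma ray_of_inj (x y : omega P -> L) : infinite_path x -> infinite_path y ->
  ray_of x = ray_of y -> x = y.
Proof.
move=> xP yP e; apply/funext => a; rewrite (segmentE a).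
have [h1 e1] := path_rayP (val a).1 (deg a) xP.
have [h2 e2] := path_rayP (val a).1 (deg a) yP.
by rewrite -e in h2 e2; apply: (compI h1 h2); rewrite -e1.
Qed.

(** The inverse of [ray_of]: the value at [(p, q)] is the initial segment of degree [q - p] of the
    tail at [p]. *)
Definition path_of f (a : omega P) : L := shift (val a).1 f (deg a).

Lemma path_ofK f : ray f -> ray_of (path_of f) = f.
Proof.
move=> fR; apply/funext => p; rewrite /ray_of /path_of -[(val _).1]/0.
rewrite (@omega_degE _ p); last by rewrite /= add0r.
have [h] := shiftP 0 p fR; rewrite add0r => ->.
have -> : f 0 = rng (shift 0 f p).
  by rewrite -h; apply/esym/src_vertex; exact: ray_rng.
by rewrite (comp_rng Lcat).
Qed.

Lemma path_ofP f : ray f -> infinite_path (path_of f).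
Proof.
move=> fR; have sR m := ray_shift m fR.
split=> [a|a|a b ab|a]; rewrite /path_of.
- rewrite (@omega_degE (rng a) 0) ?addr0// -[(val (rng a)).1]/((val a).1).
  by rewrite ray_rng.
- rewrite (@omega_degE (src a) 0) ?addr0// -[(val (src a)).1]/((val a).2).
  rewrite shift0//; have [h e] := shiftP (val a).1 (deg a) fR.
  by rewrite omega_deg e srcc.
- have vE := omega_compE ab.
  have -> : deg (compose a b) = deg a + deg b.
    apply: omega_degE; rewrite vE -[(_, _).2]/((val b).2) (omega_deg b).
    by rewrite -(omega_composable ab) (omega_deg a) addrA.
  rewrite vE -[(_, _).1]/((val a).1).
  rewrite (shiftP (deg a) (deg b) (sR (val a).1)).2.
  rewrite shift_shift// -(omega_composable ab).
  by rewrite omega_deg.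
- by rewrite ray_deg.
Qed.

Lemma ray_of_prepend x (y : omega P -> L) : infinite_path y ->
  path_range y = src x ->
  infinite_path (prepend x y) /\ ray_of (prepend x y) = act x (ray_of y).
Proof.
move=> yP yx; have yR := ray_of_path yP.
have xy : src x = ray_of y 0 by rewrite -yx.
have aR := ray_act yR xy.
(* Either [xget] returns a member of its set, which [act_unique] identifies, or the set is empty,
   which the path of [act x (ray_of y)] refutes. *)
rewrite /prepend; case: xgetP => [z _ [zP zE]|/(_ (path_of (act x (ray_of y))))[]].
  split=> //; apply: act_unique => // [|t]; first exact: ray_of_path.
  by apply: zE; rewrite raddfD /= addrC addKr.
split; first exact: path_ofP.
move=> p t /eqP; rewrite subr_eq addrC -raddfD => /eqP/(emb_inj Pcanc) ->.
by rewrite -/(ray_of _ _) path_ofK// actE.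
Qed.

Lemma simP x y : sim x y <->
  src x = src y /\ forall f, ray f -> f 0 = src x -> act x f = act y f.
Proof.
split=> -[s h]; split=> //.
  move=> f fR fx; have fP := path_ofP fR.
  have fr : path_range (path_of f) = src x.
    by rewrite -fx -[in RHS](path_ofK fR).
  have [_] := ray_of_prepend fP fr.
  have [|_] := @ray_of_prepend y _ fP; first by rewrite -s.
  by rewrite h// path_ofK// => -> ->.
move=> z zP zx; have [xP xE] := ray_of_prepend zP zx.
have [|yP yE] := @ray_of_prepend y _ zP; first by rewrite -s.
apply: ray_of_inj => //; rewrite xE yE; apply: h => //; exact: ray_of_path.
Qed.

(** * Periodicity *)

Hypotheses (Pfg : finitely_generated P) (LW : property_W L).

(** Both ranges are the vertex at 0 of the ray obtained by prepending [x] or [y] to any ray at the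
    common source. *)
Lemma sim_rng x y : sim x y -> rng x = rng y.
Proof.
move=> /simP[s h]; have [f fR fx] := ray_exists Pfg (vertices_src x).
by rewrite -(act0 fR (esym fx)) h// act0// -s fx.
Qed.

Lemma sim_deg_inj x y : sim x y -> deg x = deg y -> x = y.
Proof.
move=> /simP[s h] d; have [f fR fx] := ray_exists Pfg (vertices_src x).
by rewrite -(act_deg fR (esym fx)) h// d act_deg// -s fx.
Qed.

(** Together with [sim_compr] this makes [sim] a congruence, so that classes can be composed. *)
Lemma sim_compl x y z : sim x y -> src z = rng x ->
  sim (compose z x) (compose z y).
Proof.
move=> xy zx; have zy : src z = rng y by rewrite -(sim_rng xy).
have /simP[s h] := xy.
apply/simP; rewrite !srcc//; split=> // f fR fx.
by rewrite !act_comp -?s// h.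
Qed.

Lemma sim_compr x y z : sim x y -> src x = rng z ->
  sim (compose x z) (compose y z).
Proof.
move=> /simP[s h] xz; have yz := etrans (esym s) xz.
apply/simP; rewrite !srcc//; split=> // f fR fz.
by rewrite !act_comp// h ?act0//; exact: ray_act.
Qed.

(** Prepending [z] is injective on rays. *)
Lemma sim_cancel x y z : src z = rng x -> src z = rng y ->
  sim (compose z x) (compose z y) -> sim x y.
Proof.
move=> zx zy /simP; rewrite !srcc// => -[s h].
apply/simP; split=> // f fR fx.
have xf : src x = f 0 by [].
have yf : src y = f 0 by rewrite -s.
have e := h f fR fx; rewrite !act_comp// in e.
by apply: act_inj e; rewrite ?act0//; exact: ray_act.
Qed.

Definition periodic v m n := forall f, ray f -> f 0 = v -> shift m f = shift n f.

Lemma sim_periodic x y : sim x y -> periodic (src x) (deg x) (deg y).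
Proof.
move=> /simP[s h] f fR fx; have xf : src x = f 0 by [].
have yf : src y = f 0 by rewrite -s.
have xR := ray_act fR xf; have yR := ray_act fR yf.
rewrite -[f in LHS](shift_act fR yf) -[f in RHS](shift_act fR xf).
by rewrite !shift_shift// h// addrC.
Qed.

(** A ray at [w] is a tail of a ray at [v], obtained by prepending a connecting path, and shifts
    commute. *)
Lemma connected_periodic v w m n : connected v w ->
  periodic v m n -> periodic w m n.
Proof.
move=> [a [av aw]] h f fR fw; have af : src a = f 0 by rewrite aw.
have aR := ray_act fR af; rewrite -(shift_act fR af) !shift_shift//.
rewrite ![deg a + _]addrC -!shift_shift//.
by rewrite h// act0.
Qed.

Lemma periodicD v m n m' n' : periodic v m n -> periodic v m' n' ->
  periodic v (m + m') (n + n').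
Proof.
move=> h h' f fR fv; rewrite -shift_shift// (h f)// shift_shift//.
(* The shift by [m'] is moved innermost, because [h'] speaks only of rays at [v] and [shift n f] may
   start elsewhere. *)
by rewrite ![n + _]addrC -!shift_shift// h'.
Qed.

Lemma periodicC v m n : periodic v m n -> periodic v n m.
Proof. by move=> h f fR fv; rewrite h. Qed.

Lemma PerP g : reflect (exists x y : L, sim x y /\ g = emb (deg x) - emb (deg y))
  (g \in Per L).
Proof. exact: asboolP. Qed.

Lemma Per_sim x y : sim x y -> emb (deg x) - emb (deg y) \in Per L.
Proof. by move=> xy; apply/PerP; exists x, y. Qed.

(* Factor a path of degree m + n as x x' = y y' with deg x = m, deg y = n:
   on rays through it the two shifts remove x and y, so x' ~ y'. *)
Lemma periodic_Per v m n : vertices v -> periodic v m n ->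
  emb m - emb n \in Per L.
Proof.
move=> vv h; have [z [zv zd]] := source_free LP (m + n) vv.
have [[x x'] [[/= xd xd' xx' zx] _]] := factorization LP zd.
rewrite addrC in zd.
have [[y y'] [[/= yd yd' yy' zy] _]] := factorization LP zd.
(* The order is swapped: the remainder [y'] has degree [m] and [x'] has degree [n]. *)
apply/PerP; exists y', x'; rewrite yd' xd'; split=> //; apply/sim_sym/simP.
have s : src x' = src y' by rewrite -(srcc xx') -zx zy srcc.
split=> // f fR fx; have xf : src x' = f 0 by [].
have yf : src y' = f 0 by rewrite -s.
have zf : src z = f 0 by rewrite zx srcc.
have xR := ray_act fR xf; have yR := ray_act fR yf.
have := h (act z f) (ray_act fR zf) (etrans (act0 fR zf) zv).
rewrite {1}zx zy !act_comp// -xd -yd !shift_act ?act0//.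
Qed.

Lemma Per_zmod_closed : [set: L] !=set0 -> zmod_closed (Per L).
Proof.
move=> [x0 _]; split.
  by apply/PerP; exists x0, x0; rewrite subrr; split=> //; exact: sim_refl.
move=> _ _ /PerP[x [y [xy ->]]] /PerP[x' [y' [xy' ->]]].
have [w [wv xw xw']] := LW (vertices_src x) (vertices_src x').
have h := connected_periodic xw (sim_periodic xy).
have h' := connected_periodic xw' (sim_periodic xy').
have := periodic_Per wv (periodicD h (periodicC h')).
by rewrite !embD opprD opprB addrACA.
Qed.

(** Prepend a path [a] from [v] to [w]: the difference of [deg a + deg x] and [deg a + p] is still a
    period, so [v] supplies a path equivalent to [compose a x]. It begins with [a], and cancelling
    [a] leaves the path sought at [w]. *)
Lemma VPer_connected v w : VPer L v -> vertices w -> connected v w -> VPer L w.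
Proof.
move=> [vv vP] wv [a [av aw]]; split=> // x p xw xp.
have ax : src a = rng x by rewrite xw.
have [||y [yv yd xy]] := vP (compose a x) (deg a + p).
- by rewrite rngc.
- by rewrite degc// !embD opprD addrACA subrr add0r.
have [[a' z] [[/= ad zd az yE] _]] := factorization LP yd.
have /simP[s h] := xy.
have [f fR fx] := ray_exists Pfg (vertices_src (compose a x)).
have axf : src x = f 0 by rewrite fx srcc.
have zf : src z = f 0 by rewrite fx s yE srcc.
(* Both are the initial segment of degree [deg a] of one ray, since the composites are
   equivalent. *)
have {fR fx} aa' : a = a'.
  have xR := ray_act fR axf; have zR := ray_act fR zf.
  have /(congr1 (@^~ (deg a))) := h f fR fx.
  rewrite yE !act_comp// act_deg ?act0// => ->.
  by rewrite -ad act_deg ?act0.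
subst a'; exists z; split=> //; first by rewrite -az.
by apply: (@sim_cancel _ _ a); rewrite -?yE.
Qed.

Lemma VPer_hereditary : hereditary (VPer L).
Proof. by split=> [v []//|v w]; exact: VPer_connected. Qed.

(** * The subgraph of paths with range in a hereditary set *)

Section Restriction.
Variable S : set L.
Hypothesis HS : hereditary S.
Let R := restriction S.

Lemma restriction_rng (a : R) : S (rng (val a)).
Proof. exact: set_mem (valP a). Qed.

(** Heredity keeps sources inside the restriction, so [insubd] in its source map never falls back on
    its default. *)
Lemma restriction_src (a : R) : S (src (val a)).
Proof.
apply: (HS.2 _ _ (restriction_rng a)); first exact: vertices_src.
by exists (val a).
Qed.

Lemma val_rng (a : R) : val (rng a) = rng (val a).
Proof. by rewrite val_insubd rngr (valP a). Qed.

Lemma val_src (a : R) : val (src a) = src (val a).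
Proof. by rewrite val_insubd rngs (mem_set (restriction_src a)). Qed.

Lemma src_rng_val (a b : R) : src a = rng b -> src (val a) = rng (val b).
Proof. by rewrite -val_src -val_rng => ->. Qed.

Lemma val_src_rng (a b : R) : src (val a) = rng (val b) -> src a = rng b.
Proof. by rewrite -val_src -val_rng => /val_inj. Qed.

Lemma val_comp (a b : R) : src a = rng b ->
  val (compose a b) = compose (val a) (val b).
Proof.
by move=> /src_rng_val ab; rewrite val_insubd rngc// (valP a).
Qed.

Definition lift_mor x (h : S (rng x)) : R := exist _ x (mem_set h).

Lemma restriction_category : is_category R.
Proof.
split=> [a|a|a|a|a b ab|a b ab|a|a|a b c ab bc]; apply: val_inj.
- by rewrite !val_rng rngr.
- by rewrite val_src !val_rng srcr.
- by rewrite val_rng !val_src rngs.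
- by rewrite !val_src srcs.
- by rewrite !val_rng val_comp// rngc//; exact: src_rng_val.
- by rewrite !val_src val_comp// srcc//; exact: src_rng_val.
- rewrite val_comp ?val_rng ?(comp_rng Lcat)//.
  by apply: val_src_rng; rewrite val_rng.
- rewrite val_comp ?val_src ?(comp_src Lcat)//.
  by apply: val_src_rng; rewrite val_src.
- have vab := src_rng_val ab; have vbc := src_rng_val bc.
  rewrite !val_comp//; first exact: compA.
    by apply: val_src_rng; rewrite val_comp// srcc.
  by apply: val_src_rng; rewrite val_comp// rngc.
Qed.

Lemma restriction_pgraph : is_pgraph R.
Proof.
split.
- exact: restriction_category.
- have /countable_injP[g /in2TT gi] := pgraph_countable LP.
  apply/countable_injP; exists (g \o val) => a b _ _ /gi; exact: val_inj.
- move=> v /(congr1 val) vv; apply: (deg_id LP (v := val v)).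
  by rewrite /vertices /= -val_rng.
- move=> a b ab; rewrite -degc; first by rewrite -val_comp.
  exact: src_rng_val.
- move=> a p q /(factorization LP)[[y z] [[/= yd zd yz e] yzP]].
  have ye : rng y = rng (val a) by rewrite -(rngc yz) -e.
  have yS : S (rng y) by rewrite ye; exact: restriction_rng.
  have zS : S (rng z) by rewrite -yz; exact: (restriction_src (lift_mor yS)).
  have h : src (lift_mor yS) = rng (lift_mor zS) by apply: val_src_rng.
  exists (lift_mor yS, lift_mor zS); split.
    by split=> //; apply: val_inj; rewrite val_comp.
  move=> [b c] [/= bd cd bc ae]; have vbc := src_rng_val bc.
  have [hy hz] : (y, z) = (val b, val c).
    by apply: yzP; split=> //=; rewrite ae val_comp.
  by congr pair; apply: val_inj.
- move=> v p /(congr1 val); rewrite val_rng => vv.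
  have fin := row_finite LP p vv.
  (* As [insubd] undoes [val], the set in question lies in the image of a finite set of paths of
     [L]. *)
  pose g x : R := insubd v x.
  apply: sub_finite_set (finite_image g fin) => a [av ad].
  exists (val a); last by rewrite /g valKd.
  by split=> //; rewrite -val_rng av.
- move=> v p /(congr1 val); rewrite val_rng => vv.
  have [x [xv xd]] := source_free LP p vv.
  have xS : S (rng x) by rewrite xv -vv; exact: restriction_rng.
  by exists (lift_mor xS); split=> //; apply: val_inj; rewrite val_rng.
Qed.

End Restriction.

(** * The quotient graph *)

Section Gamma.
Variable HPer : zmod_closed (Per L).
Let R := restriction (VPer L).
Let G := Gamma HPer.
Let HV := VPer_hereditary.
Let Rcat : is_category R := restriction_category HV.

Lemma qmap_eq p q : qmap HPer p = qmap HPer q <-> emb p - emb q \in Per L.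
Proof.
rewrite -[_ - _ \in _]/(_ - _ \in subgroup HPer) Quotient.idealrBE.
by split=> /eqP.
Qed.

Lemma qrestr_eq p q : qrestr HPer p = qrestr HPer q <-> emb p - emb q \in Per L.
Proof.
rewrite -qmap_eq; split=> [/(congr1 val)//|e]; exact: val_inj.
Qed.

Lemma qrestr_sim x y : sim x y -> qrestr HPer (deg x) = qrestr HPer (deg y).
Proof. by move=> /Per_sim/qrestr_eq. Qed.

Lemma qrestr_surj (a : qP HPer) : exists p, a = qrestr HPer p.
Proof. by have /asboolP[p e] := valP a; exists p; apply: val_inj. Qed.

(** The monoid lies in the quotient group, where addition cancels. *)
Lemma qP_cancellative : cancellative (qP HPer).
Proof.
move=> a b c /(congr1 val); rewrite !raddfD => /addrI; exact: val_inj.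
Qed.

Lemma qP_finitely_generated : finitely_generated (qP HPer).
Proof.
have [s sP] := Pfg; exists (map (qrestr HPer) s) => a.
have [p ->] := qrestr_surj a; have [c ->] := sP p.
exists (fun i => c (cast_ord (size_map _ _) i)).
rewrite raddf_sum (reindex (cast_ord (size_map (qrestr HPer) s))) /=; last first.
  by exists (cast_ord (esym (size_map _ _))) => i _; rewrite ?cast_ordK ?cast_ordKV.
apply: eq_bigr => i _; rewrite raddfMn (nth_map 0)//.
by case: i => i /=; rewrite size_map.
Qed.

Lemma cls_eq (a b : R) : cls a = cls b <-> sim (val a) (val b).
Proof.
split=> [/eqP|h]; first by rewrite /cls piE => /asboolP.
by apply/eqP; rewrite /cls piE; apply/asboolP.
Qed.

Lemma cls_surj (X : G) : exists a : R, X = cls a.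
Proof. by exists (repr X); rewrite /cls reprK. Qed.

Lemma cls_sim_rep (a : R) : sim (val (repr (cls a))) (val a).
Proof. by apply/cls_eq; rewrite /cls reprK. Qed.

(** Equivalent paths share their source, and a vertex is its own source. *)
Lemma cls_vertex_inj (a b : R) : vertices a -> vertices b ->
  cls a = cls b -> a = b.
Proof.
move=> av bv /cls_eq[h _]; apply: val_inj.
have vs (c : R) : vertices c -> val c = src (val c).
  by move=> cv; rewrite -(val_src HV) -[c in src c]cv (src_rng Rcat) cv.
by rewrite vs// h -vs.
Qed.

Lemma Gamma_rng (a : R) : rng (cls a : G) = cls (rng a).
Proof.
congr cls; apply: val_inj; rewrite !(val_rng _).
exact: sim_rng (cls_sim_rep a).
Qed.

Lemma Gamma_src (a : R) : src (cls a : G) = cls (src a).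
Proof.
congr cls; apply: val_inj; rewrite !(val_src HV).
exact: (cls_sim_rep a).1.
Qed.

Lemma Gamma_deg (a : R) : deg (cls a : G) = qrestr HPer (deg a).
Proof. exact: qrestr_sim (cls_sim_rep a). Qed.

(** No two vertices are identified, so composable classes have composable representatives, whichever
    are chosen. *)
Lemma Gamma_composable (a b : R) :
  src (cls a : G) = rng (cls b : G) -> src a = rng b.
Proof.
rewrite Gamma_src Gamma_rng; apply: cls_vertex_inj.
  exact: (rng_src Rcat).
exact: (rng_rng Rcat).
Qed.

Lemma Gamma_comp (a b : R) : src a = rng b ->
  compose (cls a : G) (cls b) = cls (compose a b).
Proof.
move=> ab; have vab := src_rng_val HV ab.
have ha := cls_sim_rep a; have hb := cls_sim_rep b.
have rab : src (val (repr (cls a))) = rng (val (repr (cls b))).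
  by rewrite ha.1 vab (sim_rng hb).
apply/cls_eq; rewrite !(val_comp HV)//; last exact: val_src_rng.
apply: sim_trans (sim_compr ha rab) _.
by apply: sim_compl hb _; rewrite -rab ha.1.
Qed.

Lemma Gamma_category : is_category G.
Proof.
split=> [X|X|X|X|X Y|X Y|X|X|X Y Z].
- by have [a ->] := cls_surj X; rewrite !Gamma_rng (rng_rng Rcat).
- by have [a ->] := cls_surj X; rewrite Gamma_rng Gamma_src (src_rng Rcat).
- by have [a ->] := cls_surj X; rewrite Gamma_src Gamma_rng (rng_src Rcat).
- by have [a ->] := cls_surj X; rewrite !Gamma_src (src_src Rcat).
- have [[a ->] [b ->]] := (cls_surj X, cls_surj Y) => /Gamma_composable ab.
  by rewrite Gamma_comp// !Gamma_rng (rng_comp Rcat).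
- have [[a ->] [b ->]] := (cls_surj X, cls_surj Y) => /Gamma_composable ab.
  by rewrite Gamma_comp// !Gamma_src (src_comp Rcat).
- have [a ->] := cls_surj X.
  by rewrite Gamma_rng Gamma_comp ?(src_rng Rcat)// (comp_rng Rcat).
- have [a ->] := cls_surj X.
  by rewrite Gamma_src Gamma_comp ?(rng_src Rcat)// (comp_src Rcat).
- have [a ->] := cls_surj X; have [b ->] := cls_surj Y; have [c ->] := cls_surj Z.
  move=> /Gamma_composable ab /Gamma_composable bc.
  rewrite !Gamma_comp ?(rng_comp Rcat) ?(src_comp Rcat)//.
  by rewrite (comp_assoc Rcat).
Qed.

(** The condition defining [VPer], read in the quotient: a class has a representative in every
    degree lying over its own. With [cls_deg_inj] it is unique. *)
Lemma cls_lift_degree (a : R) p : qrestr HPer (deg a) = qrestr HPer p ->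
  exists b : R, [/\ rng b = rng a, deg b = p & cls a = cls b].
Proof.
move=> /qrestr_eq ap; have [_ vP] := restriction_rng a.
have [y [ya yp xy]] := vP (val a) p erefl ap.
have yV : VPer L (rng y) by rewrite ya; exact: restriction_rng.
exists (lift_mor yV); split=> //; last by apply/cls_eq.
by apply: val_inj; rewrite !val_rng.
Qed.

Lemma cls_deg_inj (a b : R) : cls a = cls b -> deg a = deg b -> a = b.
Proof. by move=> /cls_eq ab d; apply: val_inj; exact: sim_deg_inj. Qed.

Lemma Gamma_vertex (X : G) : vertices X ->
  exists2 v : R, vertices v & X = cls v.
Proof.
have [a ->] := cls_surj X; rewrite /vertices /= => e.
exists (rng a); first exact: (rng_rng Rcat).
by rewrite -Gamma_rng.
Qed.

Lemma Gamma_pgraph : is_pgraph G.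
Proof.
have RP : is_pgraph R := restriction_pgraph HV.
split.
- exact: Gamma_category.
- have /countable_injP[g /in2TT gi] := pgraph_countable RP.
  apply/countable_injP; exists (fun X : G => g (repr X)) => X Y _ _ /gi e.
  by rewrite -[X]reprK e reprK.
- move=> X /Gamma_vertex[v vv ->].
  by rewrite Gamma_deg (deg_id RP vv) raddf0.
- move=> X Y; have [a ->] := cls_surj X; have [b ->] := cls_surj Y.
  move=> /Gamma_composable ab.
  by rewrite Gamma_comp// !Gamma_deg (deg_comp RP)// raddfD.
- move=> X A B; have [a ->] := cls_surj X.
  have [p ->] := qrestr_surj A; have [q ->] := qrestr_surj B.
  (* The representative is replaced by one of degree exactly [p + q], which can be factored in
     [R]. *)
  rewrite Gamma_deg -raddfD => /cls_lift_degree[b [_ bd ->]] {a X A B}.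
  have [[c d] [[cp dq cd e] cdP]] := factorization RP bd.
  exists (cls c, cls d); split.
    split.
    - exact: etrans (Gamma_deg c) (congr1 (qrestr HPer) cp).
    - exact: etrans (Gamma_deg d) (congr1 (qrestr HPer) dq).
    - apply: etrans (Gamma_src c) _.
      exact: etrans (congr1 (@cls _ L) cd) (esym (Gamma_rng d)).
    - exact: etrans (congr1 (@cls _ L) e) (esym (Gamma_comp cd)).
  (* For uniqueness, the factors get representatives of degrees [p] and [q]; their composite has the
     class and the degree of [b], hence equals [b]. *)
  move=> [Y Z]; rewrite -[(Y, Z).1]/Y -[(Y, Z).2]/Z.
  have [y ->] := cls_surj Y; have [z ->] := cls_surj Z.
  rewrite !Gamma_deg; case => /cls_lift_degree[y' [_ yd ->]].
  move=> /cls_lift_degree[z' [_ zd ->]] /Gamma_composable yz.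
  rewrite Gamma_comp// => /cls_deg_inj; rewrite bd (deg_comp RP)// yd zd.
  by move=> /(_ erefl) byz; have [-> ->] := cdP (y', z') (And4 yd zd yz byz).
- move=> X A /Gamma_vertex[v vv ->]; have [p ->] := qrestr_surj A.
  (* Every class counted here has a representative of degree [p] with range [v], and there are
     finitely many of those. *)
  apply: sub_finite_set (finite_image (@cls _ L) (row_finite RP p vv)) => Y.
  have [a ->] := cls_surj Y; case=> av.
  rewrite Gamma_deg => /cls_lift_degree[b [ba bd ab]]; exists b => //; split=> //.
  apply: cls_vertex_inj => //; first exact: (rng_rng Rcat).
  by rewrite ba -Gamma_rng.
- move=> X A /Gamma_vertex[v vv ->]; have [p ->] := qrestr_surj A.
  have [a [av ad]] := source_free RP p vv.
  by exists (cls a); rewrite Gamma_rng Gamma_deg av ad.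
Qed.

(** * The isomorphism with the pullback *)

Let B := pullback (qrestr HPer) G.

Definition to_pullback (a : R) : B :=
  exist (fun Xp : _ * _ => deg (Xp.1 : G) == qrestr HPer Xp.2) (cls a, deg a)
    (introT eqP (Gamma_deg a)).

(** The pullback operations are given by [insubd]; as the pair meets the degree condition, the
    default [z] is irrelevant. *)
Lemma to_pullback_insubd (a : R) (z : B) (Xp : (G : choiceType) * P) :
  Xp = (cls a, deg a) -> to_pullback a = insubd z Xp.
Proof. by move=> ->; exact: esym (valKd z (to_pullback a)). Qed.

Lemma to_pullback_isomorphism : is_isomorphism to_pullback.
Proof.
have RP : is_pgraph R := restriction_pgraph HV.
split; first split.
- move=> a; apply: to_pullback_insubd; congr pair; first exact: Gamma_rng.
  by rewrite (deg_id RP (v := rng a))//; exact: (rng_rng Rcat).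
- move=> a; apply: to_pullback_insubd; congr pair; first exact: Gamma_src.
  by rewrite (deg_id RP (v := src a))//; exact: (rng_src Rcat).
- move=> a b ab; apply: to_pullback_insubd; congr pair.
    exact: Gamma_comp.
  by rewrite (deg_comp RP).
- by [].
have Finj : injective to_pullback.
  by move=> a b /(congr1 val)[]; exact: cls_deg_inj.
have /choice[g gP] (Xp : B) : exists a, to_pullback a = Xp.
  case: Xp => -[X p] Xp; have [a aX] := cls_surj X; subst X.
  (* Surjectivity: the degree condition of the pullback says precisely that the class has a
     representative of degree [p]. *)
  have [b [_ bp ab]] := cls_lift_degree (etrans (esym (Gamma_deg a)) (eqP Xp)).
  by exists b; apply: val_inj; exact: congr2 (esym ab) bp.
by exists g => // a; apply: Finj; rewrite gP.
Qed.

End Gamma.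

End PGraph.

Theorem theorem5p2 (P : nmodType) (L : graph_data P) :
  cancellative P -> finitely_generated P ->
  is_pgraph L -> [set: L] !=set0 -> property_W L ->
  exists HPer : zmod_closed (Per L),
  [/\ (VPer L !=set0 -> hereditary (VPer L)),
      [/\ cancellative (qP HPer), finitely_generated (qP HPer),
          is_pgraph (Gamma HPer) &
          forall x : restriction (VPer L),
          [/\ rng (cls x : Gamma HPer) = cls (rng x),
              src (cls x : Gamma HPer) = cls (src x),
              deg (cls x : Gamma HPer) = qrestr HPer (deg x) &
              forall y : restriction (VPer L), src x = rng y ->
                compose (cls x : Gamma HPer) (cls y) = cls (compose x y)]],
      is_pgraph (restriction (VPer L)) &
      exists F : restriction (VPer L) -> pullback (qrestr HPer) (Gamma HPer),
        (forall x, val (F x) = (cls x, deg x)) /\ is_isomorphism F].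
Proof.
move=> Pc Pfg LP L0 LW; have HPer := Per_zmod_closed Pc LP LW L0.
have HV := VPer_hereditary Pc LP Pfg.
exists HPer; split.
- by [].
- split; [exact: qP_cancellative|exact: qP_finitely_generated|exact: Gamma_pgraph|].
  move=> x; split; [exact: Gamma_rng|exact: Gamma_src|exact: Gamma_deg|].
  by move=> y; exact: Gamma_comp.
- exact: restriction_pgraph.
- exists (to_pullback HPer); split=> //.
  exact: to_pullback_isomorphism.
Qed.
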